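(* There exists an algorithm which, given monic polynomials $N,S,r\in\mathbb{Z}[x]$ with $\gcd(N,S)=\gcd(S,r)=1$ and $3\deg(S)\ge\deg(N)$, outputs the divisors $D$ of $N$ in $\mathbb{Z}[x]$ of the form $D=Sf+r$ for some $f\in\mathbb{Z}[x]$. It runs in $O(\deg(N))$ elementary operations in $\mathbb{Z}[x]$.
   Context: ''Elementary operations'' means additions, multiplications, subtractions, (Euclidean) divisions, and square root extractions. *)

(* Defs.v *)
From HB Require Import structures.
From mathcomp Require Import all_boot all_order all_algebra.
From mathcomp Require Import boolp classical_sets.

Set Implicit Arguments.
Unset Strict Implicit.
Unset Printing Implicit Defensive.

Import Order.TTheory GRing.Theory Num.Theory.
Local Open Scope ring_scope.

Definition deg (p : {poly int}) : nat := (size p).-1.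

(* Divisibility in the ring Z[x].  The library's [%|] on [{poly int}] is
   pseudo-divisibility, for which 2 *: 'X divides 'X. *)
Definition dvdZX (d p : {poly int}) : Prop := exists q, p = q * d.

Definition gcd1ZX (p q : {poly int}) : Prop :=
  forall d, dvdZX d p -> dvdZX d q -> d \is a GRing.unit.

(* Euclidean division in Z[x]: the unique (q, r) such that a = q b + r and
   deg r < deg b.  It exists when b is monic, but not in general; when there is
   none (including b = 0), the convention is that the dividend is left
   unreduced, i.e. the result is (0, a). *)
Definition edivZX (a b : {poly int}) : {poly int} * {poly int} :=
  xget (0, a)
    [set qr : {poly int} * {poly int} |
       a = qr.1 * b + qr.2 /\ (size qr.2 < size b)%N]%classic.

(* The square root of a with nonnegative leading coefficient, or 0 when a is
   not a square in Z[x]. *)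
Definition sqrtZX (a : {poly int}) : {poly int} :=
  xget 0 [set w : {poly int} | w ^+ 2 = a /\ 0 <= lead_coef w]%classic.

(* Algorithms over Z[x] are programs of a while-language whose variables, named
   by natural numbers, hold elements of Z[x].  Data can be inspected only by
   testing a variable for zero. *)
Definition store := nat -> {poly int}.

Definition upd (s : store) (x : nat) (p : {poly int}) : store :=
  fun y => if y == x then p else s y.

Inductive elop : Type :=
  | OAdd (x y z : nat)
  | OSub (x y z : nat)
  | OMul (x y z : nat)
  | ODiv (q r y z : nat)
  | OSqrt (x y : nat).

Definition run_elop (o : elop) (s : store) : store :=
  match o with
  | OAdd x y z => upd s x (s y + s z)
  | OSub x y z => upd s x (s y - s z)
  | OMul x y z => upd s x (s y * s z)
  | ODiv q r y z =>
      upd (upd s q (edivZX (s y) (s z)).1) r (edivZX (s y) (s z)).2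
  | OSqrt x y => upd s x (sqrtZX (s y))
  end.

Inductive prog : Type :=
  | PSkip
  | POp (o : elop)
  | PConst (x : nat) (c : {poly int})
  | PCopy (x y : nat)
  | POutput (x : nat)
  | PSeq (p q : prog)
  | PIfZero (x : nat) (p q : prog)
  | PWhileNonzero (x : nat) (p : prog).

(* [exec p s s' out n]: started in store s, the program p halts in store s',
   having output the items of out in this order and having performed n
   elementary operations. *)
Inductive exec : prog -> store -> store -> seq {poly int} -> nat -> Prop :=
  | exec_skip s : exec PSkip s s [::] 0
  | exec_op o s : exec (POp o) s (run_elop o s) [::] 1
  | exec_const x c s : exec (PConst x c) s (upd s x c) [::] 0
  | exec_copy x y s : exec (PCopy x y) s (upd s x (s y)) [::] 0
  | exec_output x s : exec (POutput x) s s [:: s x] 0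
  | exec_seq p q s1 s2 s3 o1 o2 n1 n2 :
      exec p s1 s2 o1 n1 -> exec q s2 s3 o2 n2 ->
      exec (PSeq p q) s1 s3 (o1 ++ o2) (n1 + n2)
  | exec_if_zero x p q s s' o n :
      s x = 0 -> exec p s s' o n -> exec (PIfZero x p q) s s' o n
  | exec_if_nonzero x p q s s' o n :
      s x <> 0 -> exec q s s' o n -> exec (PIfZero x p q) s s' o n
  | exec_while_stop x p s : s x = 0 -> exec (PWhileNonzero x p) s s [::] 0
  | exec_while_step x p s1 s2 s3 o1 o2 n1 n2 :
      s1 x <> 0 -> exec p s1 s2 o1 n1 ->
      exec (PWhileNonzero x p) s2 s3 o2 n2 ->
      exec (PWhileNonzero x p) s1 s3 (o1 ++ o2) (n1 + n2).

Lemma exec_det p s s1 s2 o1 o2 n1 n2 :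
  exec p s s1 o1 n1 -> exec p s s2 o2 n2 -> [/\ s1 = s2, o1 = o2 & n1 = n2].
Proof.
move=> H; elim: H s2 o2 n2 => {p s s1 o1 n1}.
- by move=> s s2 o2 n2 H; inversion H.
- by move=> o s s2 o2 n2 H; inversion H.
- by move=> x c s s2 o2 n2 H; inversion H.
- by move=> x y s s2 o2 n2 H; inversion H.
- by move=> x s s2 o2 n2 H; inversion H.
- move=> p q s1 s2 s3 o1 o2 n1 n2 _ IH1 _ IH2 t o n H; inversion H; subst.
  match goal with H : exec p _ _ _ _ |- _ => case: (IH1 _ _ _ H) => ? ? ? end.
  subst.
  by match goal with H : exec q _ _ _ _ |- _ =>
    case: (IH2 _ _ _ H) => ? ? ? end; subst.
- by move=> x p q s s' o n sx _ IH t o' n' H; inversion H; subst=> //; apply: IH.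
- by move=> x p q s s' o n sx _ IH t o' n' H; inversion H; subst=> //; apply: IH.
- by move=> x p s sx t o n H; inversion H; subst.
- move=> x p s1 s2 s3 o1 o2 n1 n2 sx _ IH1 _ IH2 t o n H; inversion H; subst=> //.
  match goal with H : exec p _ _ _ _ |- _ => case: (IH1 _ _ _ H) => ? ? ? end.
  subst.
  by match goal with H : exec (PWhileNonzero x p) _ _ _ _ |- _ =>
    case: (IH2 _ _ _ H) => ? ? ? end; subst.
Qed.

Definition input (N S r : {poly int}) : store := nth 0 [:: N; S; r].

(* Main.v *)
Require Import Defs.
From HB Require Import structures.
From mathcomp Require Import all_boot all_order all_algebra.
From mathcomp Require Import boolp classical_sets.
From mathcomp Require Import ring zify.

Import Order.TTheory GRing.Theory Num.Theory.
Local Open Scope ring_scope.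

(* This is Lenstra's algorithm for divisors in residue classes, with
   fractions cleared so that it stays in Z[x]. Reduce r modulo S and let D =
   S f + r be a divisor of N, with N = D E. A first run of Euclid's
   algorithm on (S, r) yields u and a nonzero integer rho with u r = rho
   modulo S.  Hence rho E = N u modulo S, so rho E = S g + e, where e is the
   remainder of N u modulo S.  Unless f = 0 or g = 0, the hypothesis
   deg N <= 3 deg S gives deg f + deg g <= deg S.

   A second run on (S, u e mod S) produces pairs (a, b) with a = b u e
   modulo S, for which a f + rho b g is known modulo S. If f is not constant, the
   run reaches a pair with deg a + deg f <= deg S and deg b + deg g < deg S.
   Then a f + rho b g has degree at most deg S, and its coefficient of
   degree deg S is, up to sign, that of a in degree deg S - deg f, because f
   has leading coefficient 1 or -1. So a D + rho b (rho E) is one of two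
   known polynomials; the product of its two terms is known as well, and D
   is found by solving a quadratic equation. Each run takes O(deg S)
   operations, and it is only needed when deg S <= deg N. *)

(** * Division in Z[x] *)

(* Specialized to [int] so that [lia] sees a single instance of [size]. *)
Lemma size_mulZ (p q : {poly int}) :
  p != 0 -> q != 0 -> size (p * q)%R = (size p + size q).-1.
Proof. exact: size_mul. Qed.

Lemma neq0_sizeZ (p : {poly int}) : (p != 0) = (0 < size p)%N.
Proof. by rewrite size_poly_gt0. Qed.

Lemma edivZX_eq (a b q t : {poly int}) :
  a = q * b + t -> (size t < size b)%N -> edivZX a b = (q, t).
Proof.
move=> ab tb; apply: xget_unique => //= -[q' t'] /= [ab' tb'].
have eqD : (q' - q) * b = t - t'.
  by rewrite mulrBl -[q' * b](addrK t') -ab' ab; ring.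
have lt_b : (size (t - t')%R < size b)%N.
  by rewrite (leq_ltn_trans (size_polyD _ _)) // size_polyN gtn_max tb.
move: (q' - q) (subrK q q') eqD => d <- eqD; rewrite -eqD in lt_b.
have [d0|d_neq0] := eqVneq d 0.
  by move: eqD; rewrite d0 mul0r add0r => /esym/subr0_eq ->.
have b0 : b != 0 by rewrite neq0_sizeZ (leq_ltn_trans _ tb).
by rewrite size_mulZ // in lt_b; rewrite neq0_sizeZ in d_neq0; lia.
Qed.

Lemma edivZX_monic {a b : {poly int}} : b \is monic ->
  a = (edivZX a b).1 * b + (edivZX a b).2 /\ (size (edivZX a b).2 < size b)%N.
Proof.
move=> bm.
have lt_b : (size (Pdiv.Ring.rmodp a b) < size b)%N.
  by rewrite Pdiv.Ring.ltn_rmodp monic_neq0.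
have eq_a := Pdiv.RingMonic.rdivp_eq bm a.
by rewrite (edivZX_eq _ _ _ _ eq_a lt_b).
Qed.

Lemma edivZX_exact (q b : {poly int}) : b != 0 -> edivZX (q * b) b = (q, 0).
Proof.
by move=> b0; apply: edivZX_eq; rewrite ?addr0 // size_poly0 size_poly_gt0.
Qed.

Lemma edivZX_small (a b : {poly int}) :
  (size a < size b)%N -> edivZX a b = (0, a).
Proof. by move=> ab; apply: edivZX_eq; rewrite // mul0r add0r. Qed.

Lemma edivZX_quo_monic {a b : {poly int}} :
  a \is monic -> b \is monic -> (size b <= size a)%N ->
  (edivZX a b).1 \is monic /\ (size (edivZX a b).1 + size b = (size a).+1)%N.
Proof.
move=> am bm ba; have [eq_a lt_b] := edivZX_monic (a := a) bm.
move: (edivZX a b).1 (edivZX a b).2 eq_a lt_b => q t eq_a lt_b.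
have q0 : q != 0.
  by apply: contraTneq ba => q0; rewrite eq_a q0 mul0r add0r -ltnNge.
have b0 := monic_neq0 bm.
have lt_t : (size t < size (q * b)%R)%N.
  rewrite (leq_trans lt_b) // size_mulZ //.
  by rewrite neq0_sizeZ in q0; lia.
have := am; rewrite eq_a monicE lead_coefDl // lead_coefM (monicP bm) mulr1.
rewrite -monicE => qm; split=> //; rewrite size_polyDl // size_mulZ //.
by rewrite !neq0_sizeZ in q0 b0; lia.
Qed.

(** Programs only test for zero, so this is how they extract a coefficient: by dividing by a monic
    polynomial of the right degree. *)
Lemma edivZX_lead (a b : {poly int}) : b \is monic -> (size a <= size b)%N ->
  (edivZX a b).1 = (a`_(size b).-1)%:P.
Proof.
move=> bm ab; have b0 := monic_neq0 bm.
rewrite (edivZX_eq _ _ (a`_(size b).-1)%:P (a - (a`_(size b).-1)%:P * b)) //.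
  by rewrite addrC subrK.
rewrite neq0_sizeZ in b0; rewrite -(prednK b0) ltnS.
apply/leq_sizeP => i; rewrite leq_eqVlt coefB coefCM => /predU1P [<-|lt_i].
  by rewrite -[b`__]/(lead_coef b) (eqP bm) mulr1 subrr.
have bi : (size b <= i)%N by rewrite -(prednK b0).
by rewrite (nth_default 0 bi) (nth_default 0 (leq_trans ab bi)) mulr0 subrr.
Qed.

(** A division that does not exist leaves the dividend as remainder, here nonzero. Hence a zero
    remainder certifies divisibility even when [b] is not monic. *)
Lemma edivZX_rem_eq0 {a b : {poly int}} :
  a != 0 -> (edivZX a b).2 = 0 <-> dvdZX b a.
Proof.
move=> a0; split=> [|[q eq_a]]; last first.
  have b0 : b != 0 by apply: contraNneq a0 => b0; rewrite eq_a b0 mulr0.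
  by rewrite eq_a edivZX_exact.
rewrite /edivZX; case: xgetP => [qt _ [-> _] ->|_ a_eq0].
  by exists qt.1; rewrite addr0.
by move/eqP: a_eq0; rewrite (negbTE a0).
Qed.

Lemma sqrtZX_sqr (w : {poly int}) :
  sqrtZX (w ^+ 2) = w \/ sqrtZX (w ^+ 2) = - w.
Proof.
rewrite /sqrtZX; case: xgetP => [v _ [/eqP + _]|no_root].
  by rewrite eqf_sqr => /orP [] /eqP; [left|right].
have [w_ge0|/ltW w_le0] := leP 0 (lead_coef w).
  by case: (no_root w).
by case: (no_root (- w)); split; rewrite /= ?sqrrN ?lead_coefN ?oppr_ge0.
Qed.

(** The remainder modulo [S] is again a pseudo-multiple of [S], but of smaller size, so it
    vanishes. *)
Lemma dvdZX_monicP {S a : {poly int}} : S \is monic -> S %| a -> dvdZX S a.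
Proof.
move=> Sm Sa; have [eq_a lt_t] := edivZX_monic (a := a) Sm.
have [t0|t_neq0] := eqVneq (edivZX a S).2 0.
  by exists (edivZX a S).1; rewrite {1}eq_a t0 addr0.
have /dvdp_leq : S %| (edivZX a S).2.
  by move: Sa; rewrite {1}eq_a dvdp_addr // dvdp_mull.
by move/(_ t_neq0); rewrite leqNgt lt_t.
Qed.

(* The primitive part of a rational common divisor divides in Z[x]. *)
Lemma gcd1ZX_coprimep {p q : {poly int}} : p != 0 -> gcd1ZX p q -> coprimep p q.
Proof.
move=> p0 pq1; set g := zprimitive (gcdp p q).
have dvd_g x : gcdp p q %| x -> dvdZX g x.
  by move=> /dvdpP_int [y ->]; exists y; rewrite mulrC.
have := pq1 g (dvd_g _ (dvdp_gcdl p q)) (dvd_g _ (dvdp_gcdr p q)).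
by rewrite poly_unitE size_zprimitive => /andP [].
Qed.

Lemma gcd1ZX_Gauss {S r b : {poly int}} :
  S \is monic -> gcd1ZX S r -> dvdZX S (r * b) -> dvdZX S b.
Proof.
move=> Sm Sr [q eq_q]; apply: dvdZX_monicP => //.
rewrite -(Gauss_dvdpr b (gcd1ZX_coprimep (monic_neq0 Sm) Sr)) eq_q.
exact: dvdp_mull.
Qed.

Lemma dvdZX_monic_leq {S b : {poly int}} :
  S \is monic -> b != 0 -> dvdZX S b -> (size S <= size b)%N.
Proof. by move=> Sm b0 [q eq_b]; rewrite dvdp_leq // eq_b dvdp_mull. Qed.

Lemma size_lead_monicMD {S : {poly int}} (y t : {poly int}) :
  S \is monic -> y != 0 -> (size t < size S)%N ->
  size (S * y + t)%R = (size S + size y).-1 /\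
  lead_coef (S * y + t) = lead_coef y.
Proof.
move=> Sm y0 lt_t.
have S0 := monic_neq0 Sm.
have sM : size (S * y)%R = (size S + size y).-1 by rewrite size_mulZ.
have lt_tM : (size t < size (S * y)%R)%N.
  by rewrite sM; rewrite neq0_sizeZ in y0; lia.
by rewrite size_polyDl // lead_coefDl // lead_coefM (monicP Sm) mul1r.
Qed.

Lemma edivZX_rem_congr {S p q : {poly int}} : S \is monic ->
  dvdZX S (p - q) -> (edivZX p S).2 = (edivZX q S).2.
Proof.
move=> Sm [z eq_z]; have [eq_q lt_q] := edivZX_monic (a := q) Sm.
have eq_p : p = (z + (edivZX q S).1) * S + (edivZX q S).2.
  by rewrite mulrDl -addrA -eq_q -eq_z subrK.
by rewrite (edivZX_eq _ _ _ _ eq_p lt_q).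
Qed.

Lemma coefM_top (p q : {poly int}) (m k : nat) :
  (size p <= m.+1)%N -> (size q <= k.+1)%N -> (p * q)`_(m + k) = p`_m * q`_k.
Proof.
move=> pm qk; have lt_m : (m < (m + k).+1)%N by rewrite ltnS leq_addr.
rewrite coefM (bigD1 (Ordinal lt_m)) //= addKn big1 ?addr0 // => -[i lt_i].
rewrite -val_eqE /= neq_ltn => /orP [lt_im|lt_mi].
  by rewrite (nth_default 0 (leq_trans qk _)) ?mulr0 //; lia.
by rewrite (nth_default 0 (leq_trans pm _)) ?mul0r.
Qed.

Lemma size_cancel (p q : {poly int}) (k : nat) :
  (size p <= k)%N -> (size q <= k)%N -> p`_k.-1 = q`_k.-1 ->
  (size (p - q)%R <= k.-1)%N.
Proof.
case: k => [|k] pk qk eq_top.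
  by rewrite (leq_trans (size_polyD _ _)) // size_polyN geq_max pk.
apply/leq_sizeP => i; rewrite leq_eqVlt coefB => /predU1P [<-|lt_i].
  by rewrite eq_top subrr.
rewrite (nth_default 0 (leq_trans pk lt_i)).
by rewrite (nth_default 0 (leq_trans qk lt_i)) subrr.
Qed.

(** * Fraction-free Euclidean algorithm *)

(* [X] and [X'] only serve as degree counters: monic polynomials whose sizes are
   those of [a] and the current bound on [a']. *)
Record euclid_inv (S h a b X a' b' X' : {poly int}) : Prop := EuclidInv {
  ei_X : X \is monic;
  ei_X' : X' = 0 \/ X' \is monic;
  ei_a : size a = size X;
  ei_a' : (size a' <= size X')%N;
  ei_b : (size b + size X' <= size S)%N;
  ei_b' : (size b' + size X <= (size S).+1)%N;
  ei_ab : dvdZX S (a - b * h);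
  ei_ab' : dvdZX S (a' - b' * h);
  ei_det : a * b' - a' * b != 0 }.

Lemma euclid_inv_init {S h : {poly int}} :
  S \is monic -> (size h < size S)%N -> euclid_inv S h S 0 S h 1 S.
Proof.
move=> Sm lt_h; split; rewrite ?size_poly0 ?size_poly1 //; first by right.
- exact: ltnW.
- by exists 1; rewrite mul0r subr0 mul1r.
- by exists 0; rewrite !mul1r subrr mul0r.
- by rewrite mulr1 mulr0 subr0 monic_neq0.
Qed.

(** Division by ['X] is the decrement of a counter: it keeps the quotient monic until the constant
    1, which goes to 0. *)
Lemma edivX_counter {X : {poly int}} : X = 0 \/ X \is monic ->
  ((edivZX X 'X).1 = 0 \/ (edivZX X 'X).1 \is monic) /\
  size (edivZX X 'X).1 = (size X).-1.
Proof.
case=> [->|Xm].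
  by rewrite edivZX_small ?size_polyX size_poly0 //=; split=> //; left.
have [lt_X|le_X] := ltnP (size X) 2.
  rewrite edivZX_small ?size_polyX //= size_poly0; split; first by left.
  by case: (size X) lt_X => [|[]].
have := edivZX_quo_monic Xm (monicX _); rewrite size_polyX => /(_ le_X) [qm sq].
by split; [right | lia].
Qed.

Lemma size_polyCM_leq (c : int) (p : {poly int}) :
  (size (c%:P * p)%R <= size p)%N.
Proof. by rewrite mul_polyC size_scale_leq. Qed.

Lemma dvdZX_lin {S p q : {poly int}} (x y : {poly int}) :
  dvdZX S p -> dvdZX S q -> dvdZX S (x * p - y * q).
Proof. by move=> [u ->] [v ->]; exists (x * u - y * v); ring. Qed.

Lemma size_lin_leq (c c' : int) (y p q : {poly int}) (k : nat) :
  (size p <= k)%N -> ((size y + size q).-1 <= k)%N ->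
  (size (c%:P * p - c'%:P * y * q)%R <= k)%N.
Proof.
move=> pk qk; rewrite (leq_trans (size_polyD _ _)) // size_polyN geq_max.
rewrite (leq_trans (size_polyCM_leq _ _)) //= -mulrA.
by rewrite (leq_trans (size_polyCM_leq _ _)) // (leq_trans (size_polyMleq _ _)).
Qed.

Section EuclidStep.
Context {S h a b X a' b' X' : {poly int}}.
Hypothesis inv : euclid_inv S h a b X a' b' X'.
Hypothesis X'_neq0 : X' != 0.

Let l := (edivZX a' X').1.
Let L := (edivZX a X).1.

Lemma euclid_counter_monic : X' \is monic.
Proof. by case: inv X'_neq0 => _ [->|//]; rewrite eqxx. Qed.

Lemma euclid_l : l = (a'`_(size X').-1)%:P.
Proof. by case: inv => *; rewrite /l edivZX_lead ?euclid_counter_monic. Qed.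

Lemma euclid_L : L = (lead_coef a)%:P.
Proof.
by case: inv => Xm _ aX *; rewrite /L edivZX_lead ?aX // lead_coefE aX.
Qed.

Lemma euclid_L_neq0 : L != 0.
Proof.
case: inv => Xm _ aX *; rewrite euclid_L polyC_eq0 lead_coef_eq0.
by rewrite neq0_sizeZ aX -neq0_sizeZ monic_neq0.
Qed.

(** The top coefficient that [X'] allows in [a'] already vanishes, so the bound drops with no
    arithmetic on the pair. *)
Lemma euclid_skip : l = 0 -> euclid_inv S h a b X a' b' (edivZX X' 'X).1.
Proof.
move=> l0; have [X''P sX''] := edivX_counter (or_intror euclid_counter_monic).
case: inv => Xm _ aX a'X' bX' b'X ab ab' det; split=> //; rewrite sX''; last first.
  exact: leq_trans (leq_add (leqnn _) (leq_pred _)) bX'.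
rewrite -[a'](subr0) -[0](mulr0 0) size_cancel ?mulr0 ?size_poly0 // coef0.
by apply/eqP; rewrite -polyC_eq0 -euclid_l l0.
Qed.

(** Here [deg X <= deg X'], and the monic [Y] of degree [deg X' - deg X] plays the role of a power
    of ['X] in cancelling the top coefficient of [a']. The determinant is multiplied by [L]. *)
Lemma euclid_reduce : let Y := (edivZX X' X).1 in Y != 0 ->
  euclid_inv S h a b X (L * a' - l * Y * a) (L * b' - l * Y * b)
    (edivZX X' 'X).1.
Proof.
move=> Y Y0; have [X''P sX''] := edivX_counter (or_intror euclid_counter_monic).
have det0 := euclid_L_neq0.
case: inv => Xm _ aX a'X' bX' b'X ab ab' det.
have le_X : (size X <= size X')%N.
  by rewrite leqNgt; apply: contraNN Y0 => lt_X; rewrite /Y edivZX_small.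
have [Ym sY] := edivZX_quo_monic euclid_counter_monic Xm le_X.
rewrite -/Y in Ym sY; split=> //.
- rewrite sX'' euclid_L euclid_l -mulrA; apply: size_cancel.
  + exact: leq_trans (size_polyCM_leq _ _) a'X'.
  + rewrite (leq_trans (size_polyCM_leq _ _)) //.
    by rewrite (leq_trans (size_polyMleq _ _)) // aX sY.
  + rewrite !coefCM mulrC; congr (_ * _).
    have X0 := monic_neq0 Xm; rewrite !neq0_sizeZ in X0 Y0.
    have -> : (size X').-1 = ((size Y).-1 + (size X).-1)%N by lia.
    rewrite coefM_top ?prednK ?aX // -{1}[Y`_ _]/(lead_coef Y) (monicP Ym) mul1r.
    by rewrite lead_coefE aX.
- by rewrite sX'' (leq_trans (leq_add (leqnn _) (leq_pred _)) bX').
- rewrite addnC -leq_subRL; last by lia.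
  by rewrite euclid_L euclid_l size_lin_leq //; lia.
- rewrite (_ : _ - _ = L * (a' - b' * h) - (l * Y) * (a - b * h)); last by ring.
  exact: dvdZX_lin.
- rewrite (_ : _ - _ = L * (a * b' - a' * b)); last by ring.
  by rewrite mulf_neq0.
Qed.

(** Now [deg X' < deg X]: the pair of [a'] becomes the pivot and the former pivot is reduced by it.
    The determinant is multiplied by [- l]. *)
Lemma euclid_swap : l != 0 -> (edivZX X' X).1 = 0 ->
  let Y := (edivZX X X').1 in
  euclid_inv S h a' b' X' (l * a - L * Y * a') (l * b - L * Y * b')
    (edivZX X 'X).1.
Proof.
move=> l0 Q0 Y; have X'm := euclid_counter_monic.
case: inv => Xm _ aX a'X' bX' b'X ab ab' det.
have [X''P sX''] := edivX_counter (or_intror Xm).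
have le_X : (size X' <= size X)%N.
  rewrite leqNgt; apply/negP => lt_X.
  have [/monic_neq0] := edivZX_quo_monic X'm Xm (ltnW lt_X).
  by rewrite Q0 eqxx.
have [Ym sY] := edivZX_quo_monic Xm X'm le_X.
rewrite -/Y in Ym sY.
have X'0 := X'_neq0; have X0 := monic_neq0 Xm; have Y0 := monic_neq0 Ym.
rewrite !neq0_sizeZ in X0 Y0 X'0.
(* A pivot needs its exact size, not just a bound; [l != 0] makes the bound on [a'] sharp. *)
have a'X : size a' = size X'.
  apply/eqP; rewrite eqn_leq a'X' /= leqNgt; apply: contraNN l0 => lt_a'.
  by rewrite euclid_l (nth_default 0) // -ltnS prednK.
split=> //.
- rewrite sX'' euclid_L euclid_l -mulrA; apply: size_cancel.
  + by rewrite (leq_trans (size_polyCM_leq _ _)) // aX.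
  + rewrite (leq_trans (size_polyCM_leq _ _)) //.
    by rewrite (leq_trans (size_polyMleq _ _)) // a'X sY.
  + rewrite !coefCM mulrC.
    have -> : (size X).-1 = ((size Y).-1 + (size X').-1)%N by lia.
    rewrite coefM_top ?prednK ?a'X // -{1}[Y`_ _]/(lead_coef Y) (monicP Ym) mul1r.
    rewrite lead_coefE aX; congr (a`_ _ * _); lia.
- by rewrite sX''; lia.
- rewrite addnC -leq_subRL; last by lia.
  by rewrite euclid_L euclid_l size_lin_leq //; lia.
- rewrite (_ : _ - _ = l * (a - b * h) - (L * Y) * (a' - b' * h)); last by ring.
  exact: dvdZX_lin.
- rewrite (_ : _ - _ = - l * (a * b' - a' * b)); last by ring.
  by rewrite mulf_neq0 // oppr_eq0.
Qed.

End EuclidStep.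

(** * Lenstra's relation *)

(* Lenstra's linear relation: since [deg f + deg g <= deg S], the combination
   [a f + rho b g], known modulo [S], has degree at most [deg S], and only [a f]
   contributes to its coefficient of degree [deg S]. *)
Lemma divisor_relation (S r N u e c D E f g a b : {poly int}) (rho : int) (k : nat) :
  S \is monic -> (0 < k)%N -> rho != 0 ->
  (size r < size S)%N -> (size e < size S)%N -> (size N + 2 <= 3 * size S)%N ->
  N = D * E -> N != 0 -> D = S * f + r -> rho%:P * E = S * g + e ->
  rho%:P * N = c * S + r * e ->
  f != 0 -> g != 0 -> dvdZX S (rho%:P - u * r) -> dvdZX S (a - b * (u * e)) ->
  (k + size f = (size S).+1)%N -> (size a <= k)%N -> (size b + k <= size S)%N ->
  a * D + rho%:P * b * (rho%:P * E) =
  ((edivZX (b * u * c) S).2 + (a`_k.-1 * lead_coef f)%:P * S) * S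
  + a * r + rho%:P * b * e.
Proof.
move=> Sm k0 rho0 rS eS NS eqN N0 eqD eqE eqc f0 g0 [q1 ur] [q2 abue] kf ak bk.
have S0 := monic_neq0 Sm.
have /andP [D0 E0] : (D != 0) && (E != 0) by rewrite -negb_or -mulf_eq0 -eqN.
have rP : rho%:P != 0 :> {poly int} by rewrite polyC_eq0.
have sD : size D = (size S + size f).-1.
  by rewrite eqD (size_lead_monicMD _ _ Sm f0 rS).1.
have sE : size E = (size S + size g).-1.
  rewrite -(size_scale E rho0) -mul_polyC eqE.
  by rewrite (size_lead_monicMD _ _ Sm g0 eS).1.
have sN : size N = (size D + size E).-1 by rewrite eqN size_mulZ.
(* Expand [rho N = (S f + r) (S g + e)] and compare with [c S + r e]. *)
have eq_c : c = S * f * g + f * e + g * r.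
  apply: (mulIf S0); apply: (addIr (r * e)); rewrite -eqc eqN.
  rewrite mulrCA eqE eqD; ring.
pose z := a * f + rho%:P * b * g.
(* Modulo [S], [a = b u e] and [rho = u r], so [z = b u (e f + r g) = b u c]. *)
have z_mod : (edivZX z S).2 = (edivZX (b * u * c) S).2.
  apply: edivZX_rem_congr => //; exists (q2 * f + q1 * b * g - b * u * f * g).
  rewrite /z eq_c (_ : _ - _ = (a - b * (u * e)) * f
    + (rho%:P - u * r) * b * g - b * u * f * g * S); last by ring.
  by rewrite abue ur; ring.
rewrite !neq0_sizeZ in D0 E0 f0 g0 S0.
have s_af : (size (a * f)%R <= size S)%N.
  by rewrite (leq_trans (size_polyMleq _ _)) //; lia.
(* The bound on [N] and the choice of [k] give [size g <= k], so this term stays below degree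
   [deg S]. *)
have s_bg : (size (rho%:P * b * g)%R <= (size S).-1)%N.
  rewrite -mulrA (leq_trans (size_polyCM_leq _ _)) //.
  by rewrite (leq_trans (size_polyMleq _ _)) //; lia.
have s_z : (size z <= size S)%N.
  rewrite (leq_trans (size_polyD _ _)) // geq_max s_af.
  by rewrite (leq_trans s_bg) ?leq_pred.
have z_top : z`_(size S).-1 = a`_k.-1 * lead_coef f.
  rewrite coefD (nth_default 0 s_bg) addr0.
  have -> : (size S).-1 = (k.-1 + (size f).-1)%N by lia.
  by rewrite coefM_top ?prednK.
(* As [size z <= size S], the quotient of [z] by [S] is its coefficient of degree [deg S], so [z] is
   recovered exactly from its residue. *)
have [eq_z _] := edivZX_monic (a := z) Sm.
rewrite -z_mod -z_top -(edivZX_lead _ _ Sm s_z) [_.2 + _]addrC -eq_z.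
by rewrite eqE eqD /z; ring.
Qed.

(** The discriminant is [(x - y) ^+ 2], whose root is known only up to sign. *)
Lemma sqrtZX_discriminant (x y : {poly int}) :
  x + y + sqrtZX ((x + y) ^+ 2 - 4 * (x * y)) = x + x \/
  x + y - sqrtZX ((x + y) ^+ 2 - 4 * (x * y)) = x + x.
Proof.
rewrite (_ : _ - _ = (x - y) ^+ 2); last by ring.
by case: (sqrtZX_sqr (x - y)) => ->; [left|right]; ring.
Qed.

Lemma edivZX_rem_monic_eq0 {a b : {poly int}} : b \is monic ->
  (edivZX a b).2 = 0 <-> dvdZX b a.
Proof.
move=> bm; have [->|a0] := eqVneq a 0; last exact: edivZX_rem_eq0.
rewrite -[in edivZX _](mul0r b) edivZX_exact ?monic_neq0 //.
by split=> // _; exists 0; rewrite mul0r.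
Qed.

(** * Loop-free programs *)

Local Notation "p ;; q" := (PSeq p q) (at level 60, right associativity).

Fixpoint loop_free (p : prog) : bool :=
  match p with
  | PSeq p q | PIfZero _ p q => loop_free p && loop_free q
  | PWhileNonzero _ _ => false
  | _ => true
  end.

(* [upd] and [run_elop] with [==] on variables unfolded to [eqn], so that [cbv]
   can look up variables without unfolding [==] on polynomials. *)
Definition put (s : store) (x : nat) (p : {poly int}) : store :=
  fun y => if eqn y x then p else s y.

Definition final_elop (o : elop) (s : store) : store :=
  match o with
  | OAdd x y z => put s x (s y + s z)
  | OSub x y z => put s x (s y - s z)
  | OMul x y z => put s x (s y * s z)
  | ODiv q r y z => put (put s q (edivZX (s y) (s z)).1) r (edivZX (s y) (s z)).2
  | OSqrt x y => put s x (sqrtZX (s y))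
  end.

(** With [outputs] and [cost], this replaces derivations of [exec] by computation. The values given
    to while loops are meaningless; [exec_loop_free] excludes them. *)
Fixpoint final (p : prog) (s : store) : store :=
  match p with
  | POp o => final_elop o s
  | PConst x c => put s x c
  | PCopy x y => put s x (s y)
  | PSeq p q => final q (final p s)
  | PIfZero x p q => if s x == 0 then final p s else final q s
  | _ => s
  end.

Fixpoint outputs (p : prog) (s : store) : seq {poly int} :=
  match p with
  | POutput x => [:: s x]
  | PSeq p q => outputs p s ++ outputs q (final p s)
  | PIfZero x p q => if s x == 0 then outputs p s else outputs q s
  | _ => [::]
  end.

Fixpoint cost (p : prog) : nat :=
  match p with
  | POp _ => 1
  | PSeq p q => cost p + cost q
  | PIfZero _ p q => maxn (cost p) (cost q)
  | _ => 0
  end.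

Fixpoint writes (p : prog) : seq nat :=
  match p with
  | POp (OAdd x _ _ | OSub x _ _ | OMul x _ _ | OSqrt x _) => [:: x]
  | POp (ODiv q r _ _) => [:: q; r]
  | PConst x _ | PCopy x _ => [:: x]
  | PSeq p q | PIfZero _ p q => writes p ++ writes q
  | _ => [::]
  end.

Lemma exec_loop_free (p : prog) (s : store) : loop_free p ->
  exists2 n, exec p s (final p s) (outputs p s) n & (n <= cost p)%N.
Proof.
elim: p s => [|o|x c|x y|x|p IHp q IHq|x p IHp q IHq|//] s /=.
- by exists 0%N => //; constructor.
- by exists 1%N => //; rewrite (_ : final_elop o s = run_elop o s);
    [constructor | case: o].
- by exists 0%N => //; constructor.
- by exists 0%N => //; constructor.
- by exists 0%N => //; constructor.
- move=> /andP [/(IHp s) [n1 e1 le1] /(IHq (final p s)) [n2 e2 le2]].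
  by exists (n1 + n2)%N; [exact: exec_seq e1 e2 | exact: leq_add].
- move=> /andP [/(IHp s) [n1 e1 le1] /(IHq s) [n2 e2 le2]].
  case: eqP => sx; [exists n1 | exists n2]; rewrite ?leq_max ?le1 ?le2 ?orbT //.
    exact: exec_if_zero.
  exact: exec_if_nonzero.
Qed.

Lemma final_frame (p : prog) (s : store) (y : nat) :
  y \notin writes p -> final p s y = s y.
Proof.
elim: p s => [|o|x c|x z|x|p IHp q IHq|x p IHp q IHq|//] s //=.
- case: o => [x a b|x a b|x a b|q r a b|x a] /=; rewrite /put -?[eqn _ _]/(_ == _);
    rewrite !inE ?negb_or.
  + by move=> /negbTE ->.
  + by move=> /negbTE ->.
  + by move=> /negbTE ->.
  + by move=> /andP [/negbTE -> /negbTE ->].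
  + by move=> /negbTE ->.
- by rewrite inE /put -[eqn _ _]/(_ == _) => /negbTE ->.
- by rewrite inE /put -[eqn _ _]/(_ == _) => /negbTE ->.
- by rewrite mem_cat negb_or => /andP [yp yq]; rewrite IHq ?IHp.
- by rewrite mem_cat negb_or => /andP [yp yq]; case: ifP => _; rewrite ?IHq ?IHp.
Qed.

Definition agree (m : nat) (s s' : store) := forall y, (y < m)%N -> s' y = s y.

Lemma agree_trans {m : nat} {s1 s2 s3 : store} :
  agree m s1 s2 -> agree m s2 s3 -> agree m s1 s3.
Proof. by move=> s12 s23 y ym; rewrite s23 ?s12. Qed.

Lemma final_agree (m : nat) (p : prog) (s : store) :
  all (leq m) (writes p) -> agree m s (final p s).
Proof.
move=> /allP pm y ym; apply: final_frame; apply: contraL ym => /pm.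
by rewrite -leqNgt.
Qed.

Lemma finalS (p q : prog) (s : store) : final (p ;; q) s = final q (final p s).
Proof. by []. Qed.

Lemma finalI (x : nat) (p q : prog) (s : store) :
  final (PIfZero x p q) s = if s x == 0 then final p s else final q s.
Proof. by []. Qed.

(** * The algorithm *)

(* With the notation of the header, [vr] holds r mod S after the first step,
   [vrho], [vu] and [ve] hold rho, u and e, and [vc] holds (rho N - r e) /
   S. The state of Euclid's algorithm is in [va] to [vX'], and [vx] holds
   ['X]. Sets of registers to be preserved are initial segments. *)
Local Notation vN := 0%N (only parsing).
Local Notation vS := 1%N (only parsing).
Local Notation vr := 2%N (only parsing).
Local Notation vrho := 3%N (only parsing).
Local Notation vu := 4%N (only parsing).
Local Notation ve := 5%N (only parsing).
Local Notation vc := 6%N (only parsing).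
Local Notation va := 7%N (only parsing).
Local Notation vb := 8%N (only parsing).
Local Notation vX := 9%N (only parsing).
Local Notation va' := 10%N (only parsing).
Local Notation vb' := 11%N (only parsing).
Local Notation vX' := 12%N (only parsing).
Local Notation vx := 13%N (only parsing).
Local Notation vl := 14%N (only parsing).
Local Notation vL := 15%N (only parsing).
Local Notation vY := 16%N (only parsing).
Local Notation v1 := 17%N (only parsing).
Local Notation v2 := 18%N (only parsing).
Local Notation v3 := 19%N (only parsing).
Local Notation vD := 20%N (only parsing).
Local Notation vk := 21%N (only parsing).
Local Notation vW := 22%N (only parsing).
Local Notation vp := 23%N (only parsing).
Local Notation vrN := 24%N (only parsing).
Local Notation vP := 25%N (only parsing).
Local Notation va2 := 26%N (only parsing).
Local Notation vp2 := 27%N (only parsing).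
Local Notation vw := 28%N (only parsing).
Local Notation vs := 29%N (only parsing).
Local Notation vy := 30%N (only parsing).

Ltac eval_final := cbv beta iota delta [final final_elop put eqn].

(* Euclid's algorithm over the fraction field, performed in Z[x]: cross
   multiplication by the leading coefficients [vl] and [vL] cancels one coefficient
   at a time, so that each step lowers one of the two degree counters by 1. *)
Definition swap_block : prog :=
  POp (ODiv vY v3 vX vX') ;;
  POp (OMul v1 vl va) ;; POp (OMul v2 vL vY) ;; POp (OMul v3 v2 va') ;;
  PCopy va va' ;; POp (OSub va' v1 v3) ;;
  POp (OMul v1 vl vb) ;; POp (OMul v3 v2 vb') ;;
  PCopy vb vb' ;; POp (OSub vb' v1 v3) ;;
  PCopy v1 vX ;; PCopy vX vX' ;; PCopy vX' v1.

Definition reduce_block : prog :=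
  POp (OMul v1 vL va') ;; POp (OMul v2 vl vY) ;; POp (OMul v3 v2 va) ;;
  POp (OSub va' v1 v3) ;;
  POp (OMul v1 vL vb') ;; POp (OMul v3 v2 vb) ;; POp (OSub vb' v1 v3).

(** The last division decrements whichever counter is now in [vX']: the old [vX] after a swap.
    Unwanted remainders go to [v3]. *)
Definition euclid_step : prog :=
  POp (ODiv vl v3 va' vX') ;;
  PIfZero vl PSkip
    ((POp (ODiv vL v3 va vX) ;; POp (ODiv vY v3 vX' vX)) ;;
     PIfZero vY swap_block reduce_block) ;;
  POp (ODiv vX' v3 vX' vx).

(** * Running Euclid's algorithm as a loop *)

Definition euclid_store (S h : {poly int}) (s : store) : Prop :=
  euclid_inv S h (s va) (s vb) (s vX) (s va') (s vb') (s vX') /\ s vx = 'X.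

Lemma euclid_store_agree {S h : {poly int}} {s s' : store} :
  agree 14 s s' -> euclid_store S h s -> euclid_store S h s'.
Proof. by move=> ss'; rewrite /euclid_store !ss'. Qed.

(** In every branch the sum of the counter sizes drops by exactly one, which bounds the number of
    passes and controls which sizes are visited. *)
Lemma euclid_stepP (S h : {poly int}) (s : store) :
  euclid_store S h s -> s vX' != 0 ->
  let s' := final euclid_step s in
  euclid_store S h s' /\
  ((size (s' vX), size (s' vX')) = (size (s vX), (size (s vX')).-1) \/
   (size (s' vX), size (s' vX')) = (size (s vX'), (size (s vX)).-1) /\
   (size (s vX') < size (s vX))%N).
Proof.
case=> inv s13 s12.
have [_ sz12] := edivX_counter (or_intror (euclid_counter_monic inv s12)).
have Xm : s vX \is monic by case: inv.
have [_ sz9] := edivX_counter (or_intror Xm).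
rewrite /euclid_step !finalS finalI finalS finalI.
case: eqP; eval_final.
  move=> l0; rewrite /euclid_store s13; split.
    by split; [exact (euclid_skip inv s12 l0) | by []].
  by left; rewrite sz12.
move/eqP => l0; case: eqP; rewrite ?/swap_block ?/reduce_block; eval_final.
  move=> Y0; rewrite /euclid_store s13.
  split; first by split; [exact (euclid_swap inv s12 l0 Y0) | by []].
  right; split; first by rewrite sz9.
  rewrite ltnNge; apply/negP => le_X.
  have [/monic_neq0] := edivZX_quo_monic (euclid_counter_monic inv s12) Xm le_X.
  by rewrite Y0 eqxx.
move/eqP => Y0; rewrite /euclid_store s13.
split; first by split; [exact (euclid_reduce inv s12 Y0) | by []].
by left; rewrite sz12.
Qed.

Fixpoint silent (p : prog) : bool :=
  match p with
  | POutput _ => false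
  | PSeq p q | PIfZero _ p q => silent p && silent q
  | _ => true
  end.

Lemma silent_outputs (p : prog) (s : store) : silent p -> outputs p s = [::].
Proof.
elim: p s => //= [p IHp q IHq|x p IHp q IHq] s /andP [/(IHp s) -> /IHq -> //].
exact: if_same.
Qed.

Definition euclid (body : prog) : prog :=
  PWhileNonzero vX' (body ;; euclid_step).

(** The sum of the counter sizes bounds the passes, hence the linear cost. The last clause is what
    the search relies on: for each admissible [k], some pass runs [body] with [X'] of size exactly
    [k] and [X] still larger. *)
Lemma euclid_exec (body : prog) (S h : {poly int}) (s : store) :
  loop_free body -> all (leq 14) (writes body) -> euclid_store S h s ->
  exists s' out n,
    [/\ exec (euclid body) s s' out n,
        euclid_store S h s' /\ s' vX' = 0,
        agree va s s',
        (n <= (cost body + cost euclid_step) * (size (s vX) + size (s vX')))%N &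
        (forall D, D \in out ->
           exists2 s1, agree va s s1 & D \in outputs body s1) /\
        (forall k, (0 < k)%N -> (k <= size (s vX'))%N -> (k < size (s vX))%N ->
           exists s1, [/\ agree va s s1, euclid_store S h s1,
             size (s1 vX') = k, (k < size (s1 vX))%N &
             {subset outputs body s1 <= out}])].
Proof.
move=> lf body14; move: {2}(_ + _)%N (leqnn (size (s vX) + size (s vX'))) => m.
elim: m s => [|m IHm] s le_m inv.
  case: inv le_m => -[Xm *]; have := monic_neq0 Xm.
  by rewrite neq0_sizeZ; lia.
have [X'0|X'_neq0] := eqVneq (s vX') 0.
  exists s, [::], 0%N; split=> //; first exact: exec_while_stop.
  by split=> // k k0; rewrite X'0 size_poly0 leqNgt k0.
have ag1 := final_agree 14 body s body14; set s1 := final body s in ag1.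
have inv1 := euclid_store_agree ag1 inv.
have X'1 : s1 vX' != 0 by rewrite ag1.
have [inv2 sizes] := euclid_stepP S h s1 inv1 X'1.
have ag2 : agree va s (final euclid_step s1).
  apply: agree_trans (final_agree va euclid_step s1 isT).
  by move=> y y7; apply: ag1; rewrite (ltn_trans y7).
have [n1 ex1 le1] := exec_loop_free body s lf.
have [n2 ex2 le2] := exec_loop_free euclid_step s1 isT.
move: ex2 inv2 sizes ag2; rewrite (silent_outputs euclid_step) // !ag1 //.
move: (final euclid_step s1) => s2 ex2 inv2 sizes ag2.
have X'_gt0 : (0 < size (s vX'))%N by rewrite -neq0_sizeZ.
have X_gt0 : (0 < size (s vX))%N.
  by case: inv => -[/monic_neq0 X0 *]; rewrite -neq0_sizeZ.
have sum2 : (size (s2 vX) + size (s2 vX')).+1 = (size (s vX) + size (s vX'))%N.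
  by case: sizes => [[-> ->]|[[-> ->] _]]; rewrite -addnS prednK // addnC.
have [|s' [out [n3 [ex3 end3 ag3 le3 [out_sound out_complete]]]]] :=
  IHm s2 _ inv2.
  by rewrite -ltnS sum2.
have ag23 s3 : agree va s2 s3 -> agree va s s3 by exact: agree_trans.
exists s', (outputs body s ++ out), (n1 + n2 + n3)%N; split=> //.
- rewrite -[outputs body s]cats0.
  by apply: exec_while_step (exec_seq ex1 ex2) ex3; apply/eqP.
- exact: ag23.
- by rewrite -sum2 mulnS; apply: leq_add => //; apply: leq_add.
- split=> [D|k k0 kX' kX].
    rewrite mem_cat => /orP [D_out|/out_sound [s3 ag D_out]]; last first.
      by exists s3 => //; exact: ag23.
    by exists s.
  (* Otherwise [k] is below both sizes. Lowering [X'] by one keeps [k <= size X']; a swap makes the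
     old [X'], of size above [k], the new [X], and [k < size X] bounds [k] by the new [X']. *)
  have [k_eq|k_neq] := eqVneq k (size (s vX')).
    by exists s; split=> // D; rewrite mem_cat => ->.
  have [||s3 [ag inv3 sX' sX sub]] := out_complete k k0.
  + case: sizes => [[_ ->]|[[_ ->] _]]; rewrite -ltnS prednK //.
    by rewrite ltn_neqAle k_neq.
  + by case: sizes => [[-> _]|[[-> _] _]] //; rewrite ltn_neqAle k_neq.
  exists s3; split=> //; first exact: ag23.
  by move=> D /sub; rewrite mem_cat orbC => ->.
Qed.

(** * Filtering the candidates *)

Definition good (N S r D : {poly int}) : Prop := dvdZX D N /\ dvdZX S (D - r).

(** Every output passes this filter, so soundness never depends on where a candidate comes from. The
    candidate 0 is rejected because its division leaves the nonzero [N]. *)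
Definition test : prog :=
  POp (ODiv v3 v2 vN vD) ;;
  PIfZero v2
    ((POp (OSub v1 vD vr) ;; POp (ODiv v3 v2 v1 vS)) ;;
     PIfZero v2 (POutput vD) PSkip)
    PSkip.

Lemma mem_test (s : store) (D : {poly int}) : s vN != 0 -> s vS \is monic ->
  (D \in outputs test s) <-> D = s vD /\ good (s vN) (s vS) (s vr) D.
Proof.
move=> N0 Sm; rewrite /test; cbv beta iota delta [outputs cat]; eval_final.
have eN := @edivZX_rem_eq0 (s vN) (s vD) N0.
have eS := @edivZX_rem_monic_eq0 (s vD - s vr) (s vS) Sm.
split=> [|[-> [DN Dr]]]; last by rewrite (eN.2 DN) (eS.2 Dr) eqxx inE.
case: eqP => // /eN DN; case: eqP => // /eS Dr.
by rewrite inE => /eqP ->.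
Qed.

Lemma mem_outputsS (p q : prog) (s : store) (D : {poly int}) :
  (D \in outputs (p ;; q) s) =
  (D \in outputs p s) || (D \in outputs q (final p s)).
Proof. exact: mem_cat. Qed.

Lemma mem_outputsl {p q : prog} {s : store} {D : {poly int}} :
  D \in outputs p s -> D \in outputs (p ;; q) s.
Proof. by rewrite mem_outputsS => ->. Qed.

Lemma mem_outputsr {p q : prog} {s : store} {D : {poly int}} :
  D \in outputs q (final p s) -> D \in outputs (p ;; q) s.
Proof. by rewrite mem_outputsS orbC => ->. Qed.

Definition sound (p : prog) : Prop := forall s D, s vN != 0 -> s vS \is monic ->
  D \in outputs p s -> good (s vN) (s vS) (s vr) D.

Lemma sound_test : sound test.
Proof. by move=> s D N0 Sm /(mem_test _ _ N0 Sm) []. Qed.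

Lemma sound_silent (p : prog) : silent p -> sound p.
Proof. by move=> p_silent s D _ _; rewrite silent_outputs. Qed.

Lemma soundS (p q : prog) :
  all (leq vrho) (writes p) -> sound p -> sound q -> sound (p ;; q).
Proof.
move=> pw sp sq s D N0 Sm; rewrite mem_outputsS => /orP [/sp|/sq]; first exact.
by rewrite !(final_agree _ _ _ pw) //; apply.
Qed.

Lemma sound_silentS (p q : prog) :
  silent p -> all (leq vrho) (writes p) -> sound q -> sound (p ;; q).
Proof. by move=> p_silent pw; apply: soundS pw (sound_silent _ p_silent). Qed.

(** * Divisors from a quadratic equation *)

Definition try_root : prog :=
  POp (ODiv vD v3 vy va2) ;; test ;;
  (POp (ODiv vD v3 vy vp2) ;; POp (ODiv vD v3 vrN vD)) ;; test.

(** [vw] is a guess for the sum of the roots and [vP] is four times their product, so [vw] plus or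
    minus [vs] is twice a root. This is why [try_root] divides by [2 a] and [2 p]. *)
Definition try_roots : prog :=
  (POp (OMul vs vw vw) ;; POp (OSub vs vs vP) ;; POp (OSqrt vs vs) ;;
   POp (OAdd vy vw vs)) ;; try_root ;;
  POp (OSub vy vw vs) ;; try_root.

(** The two guesses for [a D + rho b (rho E)] are [vW] plus or minus [vk]. The division by [vX']
    reads the top coefficient of [a], and [vk] is that coefficient times [S ^+ 2]. *)
Definition search_values : prog :=
  POp (ODiv vk v3 va' vX') ;; POp (OMul vk vk vS) ;; POp (OMul vk vk vS) ;;
  POp (OMul vp vrho vb') ;; POp (OMul vrN vrho vN) ;;
  POp (OMul vW vb' vu) ;; POp (OMul vW vW vc) ;; POp (ODiv v3 vW vW vS) ;;
  POp (OMul vW vW vS) ;;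
  POp (OMul vy va' vr) ;; POp (OAdd vW vW vy) ;;
  POp (OMul vy vp ve) ;; POp (OAdd vW vW vy) ;;
  POp (OMul vP va' vp) ;; POp (OMul vP vP vrN) ;;
  POp (OAdd vP vP vP) ;; POp (OAdd vP vP vP) ;;
  POp (OAdd va2 va' va') ;; POp (OAdd vp2 vp vp).

Definition search : prog :=
  search_values ;;
  POp (OAdd vw vW vk) ;; try_roots ;; POp (OSub vw vW vk) ;; try_roots.

Lemma sound_search : sound search.
Proof.
have sound_try_root : sound try_root.
  rewrite /try_root; apply: sound_silentS; [by [] | by [] |].
  apply: soundS; [by [] | exact: sound_test |].
  by apply: sound_silentS; [| | exact: sound_test].
have sound_roots : sound try_roots.
  rewrite /try_roots; apply: sound_silentS; [by [] | by [] |].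
  apply: soundS; [by [] | exact: sound_try_root |].
  by apply: sound_silentS; [| | exact: sound_try_root].
rewrite /search; apply: sound_silentS; [by [] | by [] |].
apply: sound_silentS; [by [] | by [] |].
apply: soundS; [by [] | exact: sound_roots |].
by apply: sound_silentS; [| | exact: sound_roots].
Qed.

(* A divisor [D] = [z / a] or [rho N / (z' / p)], where [z] and [z'] are the roots
   [a * D] and [p * E] of a known quadratic polynomial. *)
Record searchable (a p D E : {poly int}) (s : store) : Prop := Searchable {
  _ : s vN != 0;
  _ : s vS \is monic;
  _ : good (s vN) (s vS) (s vr) D;
  _ : E != 0;
  _ : (a != 0) || (p != 0);
  _ : s va2 = a + a;
  _ : s vp2 = p + p;
  _ : s vrN = D * E;
  _ : s vP = 4 * (a * D * (p * E)) }.

Lemma searchable_final (q : prog) {a p D E : {poly int}} {s : store} :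
  all (fun v => v \notin [:: vN; vS; vr; va2; vp2; vrN; vP]) (writes q) ->
  searchable a p D E s -> searchable a p D E (final q s).
Proof.
move=> /allP qw; have keep v : v \in [:: vN; vS; vr; va2; vp2; vrN; vP] ->
    final q s v = s v.
  by move=> vin; apply: final_frame; apply/negP => /qw; rewrite vin.
by case=> *; split; rewrite ?keep.
Qed.

Lemma double_neq0 (a : {poly int}) : a != 0 -> a + a != 0.
Proof.
by move=> a0; rewrite -mulr2n -scaler_nat -mul_polyC mulf_neq0 // polyC_eq0.
Qed.

Lemma mem_try_root (a p D E : {poly int}) (s : store) : searchable a p D E s ->
  (a != 0 /\ s vy = a * D + a * D) \/ (p != 0 /\ s vy = p * E + p * E) ->
  D \in outputs try_root s.
Proof.
move=> sD root; rewrite /try_root; apply: mem_outputsr.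
set s1 := final _ s.
have sD1 : searchable a p D E s1 by exact: searchable_final.
case: root => [[a0 y_eq]|[p0 y_eq]].
  apply: mem_outputsl; case: sD1 => N0 Sm gD _ _ _ _ _ _.
  apply/(mem_test _ _ N0 Sm); split=> //.
  have -> : s1 vD = (edivZX (s vy) (s va2)).1 by [].
  case: sD => _ _ _ _ _ -> _ _ _.
  rewrite y_eq (_ : _ + _ = D * (a + a)); last by ring.
  by rewrite edivZX_exact // double_neq0.
apply: mem_outputsr; set s2 := final test s1; apply: mem_outputsr.
have sD2 : searchable a p D E s2 by exact: searchable_final.
have y2 : s2 vy = s vy by rewrite /s2 final_frame.
set s3 := final _ s2.
have [N0 Sm gD _ _ _ _ _ _] : searchable a p D E s3 by exact: searchable_final.
apply/(mem_test _ _ N0 Sm); split=> //.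
have -> : s3 vD = (edivZX (s2 vrN) (edivZX (s2 vy) (s2 vp2)).1).1 by [].
case: sD2 => _ _ _ E0 _ _ -> -> _.
rewrite y2 y_eq (_ : p * E + _ = E * (p + p)); last by ring.
by rewrite (edivZX_exact E) ?double_neq0 // edivZX_exact.
Qed.

Lemma mem_try_roots (a p D E : {poly int}) (s : store) : searchable a p D E s ->
  s vw = a * D + p * E -> D \in outputs try_roots s.
Proof.
move=> sD w_eq; rewrite /try_roots; apply: mem_outputsr.
set s1 := final _ s.
have sD1 : searchable a p D E s1 by exact: searchable_final.
have y1 : s1 vy = a * D + p * E
    + sqrtZX ((a * D + p * E) ^+ 2 - 4 * (a * D * (p * E))).
  by rewrite -w_eq expr2; case: sD => _ _ _ _ _ _ _ _ <-.
pose s2 := final (POp (OSub vy vw vs)) (final try_root s1).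
have sD2 : searchable a p D E s2.
  by apply: searchable_final => //; exact: searchable_final.
have y2 : s2 vy = a * D + p * E
    - sqrtZX ((a * D + p * E) ^+ 2 - 4 * (a * D * (p * E))).
  have -> : s2 vy = final try_root s1 vw - final try_root s1 vs by [].
  rewrite !(final_frame try_root) // -w_eq expr2.
  by case: sD => _ _ _ _ _ _ _ _ <-.
case: (sD) => _ _ _ _ /orP [a0|p0] _ _ _ _.
  case: (sqrtZX_discriminant (a * D) (p * E)) => eq_y.
    by apply: mem_outputsl; apply: mem_try_root sD1 _; left; rewrite y1.
  by do 2!apply: mem_outputsr; apply: mem_try_root sD2 _; left; rewrite y2.
(* When only [p != 0] is known, exchange the roots to obtain [2 p E] instead of [2 a D]. *)
rewrite ![a * D + _]addrC ![a * D * _]mulrC in y1 y2.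
case: (sqrtZX_discriminant (p * E) (a * D)) => eq_y.
  by apply: mem_outputsl; apply: mem_try_root sD1 _; right; rewrite y1.
by do 2!apply: mem_outputsr; apply: mem_try_root sD2 _; right; rewrite y2.
Qed.

Lemma mem_search (D E kappa : {poly int}) (s : store) :
  s vN != 0 -> s vS \is monic -> good (s vN) (s vS) (s vr) D -> E != 0 ->
  s vN = D * E -> s vrho != 0 -> (s va' != 0) || (s vb' != 0) ->
  (edivZX (s va') (s vX')).1 = kappa \/ (edivZX (s va') (s vX')).1 = - kappa ->
  s va' * D + s vrho * s vb' * (s vrho * E) =
    ((edivZX (s vb' * s vu * s vc) (s vS)).2 + kappa * s vS) * s vS
    + s va' * s vr + s vrho * s vb' * s ve ->
  D \in outputs search s.
Proof.
move=> N0 Sm gD E0 eqN rho0 ab0 lP rel.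
rewrite /search; apply: mem_outputsr; set s1 := final search_values s.
pose P := s va' * (s vrho * s vb') * (s vrho * s vN).
have [eW ek] : s1 vW = (edivZX (s vb' * s vu * s vc) (s vS)).2 * s vS
      + s va' * s vr + s vrho * s vb' * s ve /\
    s1 vk = (edivZX (s va') (s vX')).1 * s vS * s vS.
  by rewrite /s1 /search_values; eval_final.
have [ea2 ep2 erN eP] : [/\ s1 va2 = s va' + s va',
    s1 vp2 = s vrho * s vb' + s vrho * s vb', s1 vrN = s vrho * s vN &
    s1 vP = P + P + (P + P)].
  by rewrite /s1 /search_values; eval_final.
have ag := final_agree vrho search_values s isT; rewrite -/s1 in ag.
have [agN agS agr] : [/\ s1 vN = s vN, s1 vS = s vS & s1 vr = s vr].
  by rewrite !ag.
(* The cofactor in the quadratic equation is [rho E], so that the product of the two factors is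
   [rho N]. *)
have sD : searchable (s va') (s vrho * s vb') D (s vrho * E) s1.
  split; rewrite ?agN ?agS ?agr ?ea2 ?ep2 ?erN ?eP //.
  - exact: mulf_neq0.
  - by case/orP: ab0 => [->//|b0]; rewrite mulf_neq0 ?orbT.
  - by rewrite eqN; ring.
  - by rewrite /P eqN; ring.
set s2 := final (POp (OAdd vw vW vk)) s1.
have sD2 : searchable (s va') (s vrho * s vb') D (s vrho * E) s2.
  exact: searchable_final.
case: lP => l_eq.
  apply: mem_outputsr; apply: mem_outputsl; apply: mem_try_roots sD2 _.
  have -> : s2 vw = s1 vW + s1 vk by [].
  by rewrite rel eW ek l_eq; ring.
do 3!apply: mem_outputsr; set s3 := final _ (final try_roots s2).
have sD3 : searchable (s va') (s vrho * s vb') D (s vrho * E) s3.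
  by do 2![apply: searchable_final; first by []].
apply: mem_try_roots sD3 _.
have -> : s3 vw = final try_roots s2 vW - final try_roots s2 vk by [].
rewrite !(final_frame try_roots) //.
have -> : s2 vW = s1 vW by [].
have -> : s2 vk = s1 vk by [].
by rewrite rel eW ek l_eq; ring.
Qed.

(** * Which divisors need a search *)

Lemma intM_eq1 (x y : int) : x * y = 1 -> x = 1 \/ x = -1.
Proof.
move=> /(congr1 absz); rewrite abszM => /eqP; rewrite muln_eq1.
by move=> /andP [/eqP x1 _]; lia.
Qed.

(** The first four cases are [f = 0], [f = 1], [f = -1] and [g = 0]. As [N] is monic, [D] has
    leading coefficient 1 or -1, and [f] shares it. *)
Lemma divisor_cases (S r N u e D : {poly int}) (rho : int) :
  S \is monic -> N \is monic -> (size r < size S)%N -> (size e < size S)%N ->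
  (size N + 2 <= 3 * size S)%N -> rho != 0 -> dvdZX S (rho%:P - u * r) ->
  dvdZX S (N * u - e) -> good N S r D ->
  [\/ D = r, D = r + S, D = r - S | e != 0 /\ rho%:P * N = D * e] \/
  exists (f g E : {poly int}) k, [/\ N = D * E /\ E != 0, D = S * f + r /\ f != 0,
    rho%:P * E = S * g + e /\ g != 0,
    (k + size f = (size S).+1)%N /\ (0 < k < size S)%N &
    lead_coef f = 1 \/ lead_coef f = -1].
Proof.
move=> Sm Nm rS eS NS rho0 [q1 ur] [q2 Nu] [[E' eqN] [f' eq_f]].
have [f eqD] : exists f : {poly int}, D = S * f + r.
  by exists f'; rewrite [S * _]mulrC -eq_f subrK.
have {E'}[E {}eqN] : exists E : {poly int}, N = D * E by exists E'; rewrite mulrC.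
have N0 := monic_neq0 Nm; have S0 := monic_neq0 Sm.
have /andP [D0 E0] : (D != 0) && (E != 0) by rewrite -negb_or -mulf_eq0 -eqN.
have [f0|f0] := eqVneq f 0.
  by left; constructor 1; rewrite eqD f0 mulr0 add0r.
(* Modulo [S], [rho E = u r E = u D E = N u = e]; the witness collects the multiples of [S] along
   this chain. *)
have [g eqE] : exists g : {poly int}, rho%:P * E = S * g + e.
  exists (q2 - f * u * E + q1 * E).
  have -> : e = N * u - q2 * S by rewrite -Nu; ring.
  have {1}-> : rho%:P = q1 * S + u * r by rewrite -ur; ring.
  by rewrite eqN eqD; ring.
have [g0|g0] := eqVneq g 0.
  rewrite g0 mulr0 add0r in eqE; left; constructor 4; split.
    by rewrite -eqE mulf_neq0 ?polyC_eq0.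
  by rewrite eqN -eqE; ring.
have [sD lD] : size D = (size S + size f).-1 /\ lead_coef D = lead_coef f.
  by rewrite eqD; exact: size_lead_monicMD.
have sE : size E = (size S + size g).-1.
  rewrite -(size_scale E rho0) -mul_polyC eqE.
  by rewrite (size_lead_monicMD _ _ Sm g0 eS).1.
have sN : size N = (size D + size E).-1 by rewrite eqN size_mulZ.
have lf : lead_coef f = 1 \/ lead_coef f = -1.
  rewrite -lD; apply: (intM_eq1 _ (lead_coef E)).
  by rewrite -lead_coefM -eqN (monicP Nm).
have f_gt0 := f0; have g_gt0 := g0; have S_gt0 := S0.
rewrite !neq0_sizeZ in f_gt0 g_gt0 S_gt0.
(* In degrees, [deg N = 2 deg S + deg f + deg g], which is at most [3 deg S]. *)
have le_fg : (size f + size g <= (size S).+1)%N by clear -NS sN sD sE f_gt0 g_gt0 S_gt0; lia.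
have [f1|f1] := eqVneq (size f) 1%N.
  left; have f_const : f = (lead_coef f)%:P.
    by rewrite lead_coefE f1 -size1_polyC ?f1.
  case: lf => lf; rewrite lf in f_const; [constructor 2|constructor 3];
    rewrite eqD f_const.
    by rewrite polyC1 mulr1 addrC.
  by rewrite polyCN polyC1 mulrN1 addrC.
(* This [k] is the largest size of [a] for which [a f] has degree at most [deg S]; [k < size S]
   because [f] is not constant. *)
right; exists f, g, E, ((size S).+1 - size f)%N; split=> //; lia.
Qed.

(** At the end [a' = 0], so [S] divides [b' r] and, by coprimality, [b']. The determinant gives
    [b' != 0], so [b'] has size at least [size S], which leaves [X] only size 1: this yields the
    constant [rho]. *)
Lemma euclid_end {S r a b X a' b' : {poly int}} : S \is monic -> gcd1ZX S r ->
  euclid_inv S r a b X a' b' 0 -> size a = 1%N.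
Proof.
move=> Sm Sr [Xm _ -> + _ le_b' _ [q dvd_b'] det].
rewrite size_poly0 leqn0 size_poly_eq0 => /eqP a'0.
rewrite a'0 mul0r subr0 mulf_eq0 negb_or in det; case/andP: det => _ b'0.
have /(dvdZX_monic_leq Sm b'0) le_S : dvdZX S b'.
  apply: (gcd1ZX_Gauss Sm Sr); exists (- q).
  by rewrite mulNr -dvd_b' a'0; ring.
have := monic_neq0 Xm; rewrite neq0_sizeZ => X_gt0.
by apply/eqP; rewrite eqn_leq X_gt0 andbT -(leq_add2l (size S)) addn1
  (leq_trans _ le_b') // leq_add2r.
Qed.

(** * Combining the two Euclidean runs *)

Definition load : prog :=
  PCopy va vS ;; PConst vb 0 ;; PCopy vX vS ;;
  PCopy va' vy ;; PConst vb' 1 ;; PCopy vX' vS ;; PConst vx 'X.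

Definition prepare : prog :=
  PCopy vrho va ;; PCopy vu vb ;;
  POp (OMul ve vN vu) ;; POp (ODiv v3 ve ve vS) ;;
  POp (OMul vc vrho vN) ;; POp (OMul v1 vr ve) ;; POp (OSub vc vc v1) ;;
  POp (ODiv vc v3 vc vS).

(* The divisors with [f] constant or [g = 0]; [f = 0] is tested by [divisors]. *)
Definition special_tests : prog :=
  POp (OAdd vD vr vS) ;; test ;; POp (OSub vD vr vS) ;; test ;;
  (POp (OMul vrN vrho vN) ;; POp (ODiv vD v3 vrN ve)) ;; test.

Definition reload : prog :=
  (POp (OMul vy vu ve) ;; POp (ODiv v3 vy vy vS)) ;; load.

Definition between : prog := prepare ;; special_tests ;; reload.

Definition divisors_large : prog :=
  (PCopy vy vr ;; load) ;; euclid PSkip ;; between ;; euclid search.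

Lemma load_store (s : store) :
  s vS \is monic -> (size (s vy) < size (s vS))%N ->
  euclid_store (s vS) (s vy) (final load s) /\
  size (final load s vX) = size (s vS) /\ size (final load s vX') = size (s vS).
Proof. by move=> Sm lt_y; split; [split=> //; exact: euclid_inv_init|]. Qed.

Lemma sound_special : sound special_tests.
Proof.
rewrite /special_tests; apply: sound_silentS; [by [] | by [] |].
apply: soundS; [by [] | exact: sound_test |].
apply: sound_silentS; [by [] | by [] |].
apply: soundS; [by [] | exact: sound_test |].
by apply: sound_silentS; [| | exact: sound_test].
Qed.

Lemma mem_special (D : {poly int}) (s : store) :
  s vN != 0 -> s vS \is monic -> good (s vN) (s vS) (s vr) D ->
  [\/ D = s vr + s vS, D = s vr - s vS |
      s ve != 0 /\ s vrho * s vN = D * s ve] ->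
  D \in outputs special_tests s.
Proof.
move=> N0 Sm gD.
pose s1 := final (POp (OAdd vD vr vS)) s; pose s2 := final test s1.
pose s3 := final (POp (OSub vD vr vS)) s2; pose s4 := final test s3.
pose s5 := final (POp (OMul vrN vrho vN) ;; POp (ODiv vD v3 vrN ve)) s4.
have ag y : (y < va)%N ->
    [/\ s1 y = s y, s2 y = s y, s3 y = s y, s4 y = s y & s5 y = s y].
  move=> y7; have e1 : s1 y = s y by exact: (final_agree va).
  have e2 : s2 y = s y by rewrite -e1; exact: (final_agree va).
  have e3 : s3 y = s y by rewrite -e2; exact: (final_agree va).
  have e4 : s4 y = s y by rewrite -e3; exact: (final_agree va).
  by split=> //; rewrite -e4; exact: (final_agree va).
have [N1 _ N3 _ N5] := ag vN isT; have [S1 S2 S3 _ S5] := ag vS isT.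
have [r1 r2 r3 _ r5] := ag vr isT.
have [_ _ _ rho4 _] := ag vrho isT; have [_ _ _ e4 _] := ag ve isT.
have [_ _ _ N4 _] := ag vN isT.
case=> [D_eq|D_eq|[e0 D_eq]]; rewrite /special_tests.
- apply: mem_outputsr; apply: mem_outputsl.
  by apply/mem_test; rewrite -/s1 ?N1 ?S1 ?r1.
- do 3!apply: mem_outputsr; apply: mem_outputsl.
  apply/mem_test; rewrite -/s1 -/s2 -/s3 ?N3 ?S3 ?r3 //; split=> //.
  by rewrite D_eq -r2 -S2.
do 5!apply: mem_outputsr.
apply/mem_test; rewrite -/s1 -/s2 -/s3 -/s4 -/s5 ?N5 ?S5 ?r5 //; split=> //.
have -> : s5 vD = (edivZX (s4 vrho * s4 vN) (s4 ve)).1 by [].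
by rewrite rho4 N4 e4 D_eq edivZX_exact.
Qed.

(** Both counters start at [S] in each run, whence the factor [2 * size S]. The candidate [r] is
    excluded because [divisors] tests it beforehand. *)
Lemma divisors_large_exec (N S r : {poly int}) (s : store) :
  N \is monic -> S \is monic -> gcd1ZX S r -> (size r < size S)%N ->
  (size N + 2 <= 3 * size S)%N -> s vN = N -> s vS = S -> s vr = r ->
  exists s' out n,
    [/\ exec divisors_large s s' out n,
        (forall D, D \in out -> good N S r D),
        (forall D, good N S r D -> D != r -> D \in out) &
        (n <= cost (PCopy vy vr ;; load) + cost between +
          2 * (cost euclid_step + (cost search + cost euclid_step)) * size S)%N].
Proof.
move=> Nm Sm Sr lt_r leN sN sS sr.
have N0 := monic_neq0 Nm.
pose init := PCopy vy vr ;; load; pose s1 := final init s.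
have [n1 ex1 le1] := exec_loop_free init s isT; rewrite -/s1 in ex1.
have out1 : outputs init s = [::] by exact: silent_outputs.
have ag1 : agree va s s1 by exact: final_agree.
have [inv1 [sX1 sX'1]] : euclid_store S r s1 /\ size (s1 vX) = size S /\
    size (s1 vX') = size S.
  have := load_store (final (PCopy vy vr) s).
  rewrite -[final load _]/s1.
  have -> : final (PCopy vy vr) s vS = S by [].
  have -> : final (PCopy vy vr) s vy = r by [].
  exact.
have [s2 [out2 [n2 [ex2 [inv2 X'2] ag2 le2 [out2_nil _]]]]] :=
  euclid_exec PSkip S r s1 isT isT inv1.
have {}out2_nil D : D \in out2 -> False by case/out2_nil.
case: inv2; rewrite X'2 => inv2 _; have rho_size := euclid_end Sm Sr inv2.
have /size_poly1P [rho rho0 rho_eq] : size (s2 va) == 1%N by rewrite rho_size.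
pose s3 := final prepare s2; pose s4 := final special_tests s3.
pose s4' := final (POp (OMul vy vu ve) ;; POp (ODiv v3 vy vy vS)) s4.
pose s5 := final between s2.
have [n5 ex5 le5] := exec_loop_free between s2 isT; rewrite -/s5 in ex5.
have ag12 : agree va s s2 by exact: agree_trans ag2.
have [N2 S2 r2] : [/\ s2 vN = N, s2 vS = S & s2 vr = r] by rewrite !ag12.
have [N3 S3 r3] : [/\ s3 vN = N, s3 vS = S & s3 vr = r].
  by rewrite /s3 !(final_agree vrho).
pose u := s2 vb; pose e := (edivZX (N * u) S).2.
pose c := (edivZX (rho%:P * N - r * e) S).1.
have [rho3 u3 e3 c3] : [/\ s3 vrho = rho%:P, s3 vu = u, s3 ve = e & s3 vc = c].
  by rewrite /c /e -rho_eq -N2 -S2 -r2 /s3 /prepare; eval_final.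
have [eq_e lt_e] := edivZX_monic (a := N * u) Sm.
rewrite -/e in eq_e lt_e.
have dvd_ur : dvdZX S (rho%:P - u * r) by case: inv2; rewrite rho_eq.
have dvd_Nu : dvdZX S (N * u - e).
  by exists (edivZX (N * u) S).1; rewrite {1}eq_e addrK.
(* The quotient defining [c] is exact, since [r e = r u N = rho N] modulo [S]. *)
have eq_c : rho%:P * N = c * S + r * e.
  have : dvdZX S (rho%:P * N - r * e).
    case: dvd_ur dvd_Nu => [x ur] [y Nu]; exists (x * N + r * y).
    rewrite (_ : _ - _ = (rho%:P - u * r) * N + r * (N * u - e)); last by ring.
    by rewrite ur Nu; ring.
  move=> /(edivZX_rem_monic_eq0 Sm) rem0.
  have [+ _] := edivZX_monic (a := rho%:P * N - r * e) Sm.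
  by rewrite rem0 addr0 -/c => /(canRL (subrK _)).
have ag34 : agree va s3 s4 := final_agree va special_tests s3 isT.
have ag34' : agree va s3 s4' by apply: agree_trans ag34 _; exact: final_agree.
have ag35 : agree va s3 s5 := agree_trans ag34' (final_agree va load s4' isT).
pose h := (edivZX (u * e) S).2.
have [inv5 [sX5 sX'5]] : euclid_store S h s5 /\ size (s5 vX) = size S /\
    size (s5 vX') = size S.
  have := load_store s4'; rewrite -[final load s4']/s5.
  have -> : s4' vS = S by rewrite ag34'.
  have -> : s4' vy = h.
    have -> : s4' vy = (edivZX (s4 vu * s4 ve) (s4 vS)).2 by [].
    by rewrite !ag34 // u3 e3 S3.
  by apply=> //; case: (edivZX_monic (a := u * e) Sm).
have [s6 [out6 [n6 [ex6 _ _ le6 [out6_sound out6_complete]]]]] :=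
  euclid_exec search S h s5 isT isT inv5.
have out5 : outputs between s2 = outputs special_tests s3.
  rewrite -[LHS]/(outputs prepare s2 ++
    (outputs special_tests s3 ++ outputs reload s4)).
  by rewrite (silent_outputs prepare s2 isT) (silent_outputs reload s4 isT) cats0.
have ag25 y : (y < vrho)%N -> s5 y = s2 y.
  by move=> y3; rewrite ag35 ?(ltn_trans y3) //; exact: (final_agree vrho).
have [N5 S5 r5] : [/\ s5 vN = N, s5 vS = S & s5 vr = r] by rewrite !ag25.
have special_sound D : D \in outputs special_tests s3 -> good N S r D.
  by move/sound_special; rewrite N3 S3 r3; apply.
have special_complete D : good N S r D -> D != r ->
    [\/ D = r, D = r + S, D = r - S | e != 0 /\ rho%:P * N = D * e] ->
    D \in outputs special_tests s3.
  move=> gD D_neq cases; apply: mem_special; rewrite ?N3 ?S3 ?r3 ?rho3 ?e3 //.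
  case: cases => D_eq; first by rewrite D_eq eqxx in D_neq.
  - exact: Or31.
  - exact: Or32.
  - exact: Or33.
rewrite out1 out5 in ex1 ex5.
move: (outputs special_tests s3) ex5 special_sound special_complete {out5}.
move=> out5 ex5 special_sound special_complete.
exists s6, (out2 ++ out5 ++ out6), (n1 + (n2 + (n5 + n6)))%N; split.
- exact: exec_seq ex1 (exec_seq ex2 (exec_seq ex5 ex6)).
- move=> D; rewrite !mem_cat => /or3P [/out2_nil //|/special_sound //|].
  move=> /out6_sound [s7 ag57 /sound_search].
  by rewrite !ag57 // N5 S5 r5; apply.
- move=> D gD D_neq; rewrite !mem_cat; apply/or3P.
  have [special|] := divisor_cases _ _ _ _ _ _ _
    Sm Nm lt_r lt_e leN rho0 dvd_ur dvd_Nu gD.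
    by apply: Or32; exact: special_complete.
  move=> [f [g [E [k [[eqN E0] [eqD f0] [eqE g0] [kf /andP [k_gt0 kS]] lf]]]]].
  apply: Or33.
  have [||s7 [ag57 inv7 sX'7 sX7 sub]] := out6_complete k k_gt0.
  + by rewrite sX'5 ltnW.
  + by rewrite sX5.
  apply: sub; case: inv7 => inv7 _.
  have X'7_neq0 : s7 vX' != 0 by rewrite neq0_sizeZ sX'7.
  have lead7 := euclid_l inv7 X'7_neq0; rewrite sX'7 in lead7.
  case: inv7 => X7m _ sa7 sa'7 sb7 sb'7 _ dvd7 det7.
  have ag37 : agree va s3 s7 := agree_trans ag35 ag57.
  have [N7 S7 r7] : [/\ s7 vN = N, s7 vS = S & s7 vr = r].
    by rewrite !ag37 ?N3 ?S3 ?r3.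
  have [rho7 u7 e7 c7] :
      [/\ s7 vrho = rho%:P, s7 vu = u, s7 ve = e & s7 vc = c].
    by rewrite !ag37 ?rho3 ?u3 ?e3 ?c3.
  apply: (mem_search D E (((s7 va')`_k.-1)%:P * (lead_coef f)%:P));
    rewrite ?N7 ?S7 ?r7 ?rho7 ?u7 ?e7 ?c7 ?lead7 //.
  + by rewrite polyC_eq0.
  (* The quadratic equation is not degenerate: a nonzero determinant forbids [a' = b' = 0]. *)
  + rewrite -negb_and; apply: contraNN det7 => /andP [/eqP -> /eqP ->].
    by rewrite mulr0 mul0r subrr.
  + by case: lf => ->; [left|right]; rewrite ?polyCN polyC1 ?mulrN mulr1 ?opprK.
  rewrite -polyCM.
  apply: (divisor_relation _ _ _ _ _ _ _ _ _ _ _ _ _ _ Sm k_gt0 rho0 lt_r lt_e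
    leN eqN N0 eqD eqE eq_c f0 g0 dvd_ur) => //.
  + case: dvd7 => z eq_z; exists (z - s7 vb' * (edivZX (u * e) S).1).
    have [eq_ue _] := edivZX_monic (a := u * e) Sm.
    by rewrite mulrBl -eq_z {1}eq_ue -/h; ring.
  + by rewrite -sX'7.
  (* The strict inequality [k < size X] turns the bound [size b' + size X <= size S + 1] into
     [size b' + k <= size S]. *)
  + by rewrite -ltnS (leq_trans _ sb'7) // -addnS leq_add2l.
rewrite sX1 ?sX'1 in le2; rewrite sX5 ?sX'5 in le6; clear - le1 le2 le5 le6.
move: (size S) (cost euclid_step) (cost search) (cost between) le1 le2 le5 le6.
by move=> m c1 c2 c3 /=; lia.
Qed.

(** * The complete algorithm and its cost *)

Definition divisors : prog :=
  (POp (ODiv v3 vr vr vS) ;; PCopy vD vr) ;; test ;;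
  POp (ODiv vy v3 vN vS) ;; PIfZero vy PSkip divisors_large.

Lemma gcd1ZX_rem {S r : {poly int}} : S \is monic -> gcd1ZX S r ->
  gcd1ZX S (edivZX r S).2.
Proof.
move=> Sm Sr d [x dS] [y dr]; apply: Sr; first by exists x.
have [-> _] := edivZX_monic (a := r) Sm.
by exists ((edivZX r S).1 * x + y); rewrite {2}dS dr; ring.
Qed.

Lemma good_rem {N S r D : {poly int}} : S \is monic ->
  good N S (edivZX r S).2 D <-> dvdZX D N /\ exists f, D = S * f + r.
Proof.
move=> Sm; have [eq_r _] := edivZX_monic (a := r) Sm.
split=> -[DN [f eq_f]]; split=> //.
  exists (f - (edivZX r S).1); rewrite {2}eq_r -[D](subrK (edivZX r S).2) eq_f.
  by ring.
by exists (f + (edivZX r S).1); rewrite eq_f {1}eq_r; ring.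
Qed.

(** [D - r] is a multiple of [S] of smaller size. This justifies skipping the Euclidean runs when
    [deg N < deg S], where their cost would be linear in [deg S] rather than [deg N]. *)
Lemma good_small {N S r D : {poly int}} : S \is monic -> N != 0 ->
  (size r < size S)%N -> (size N < size S)%N -> good N S r D -> D = r.
Proof.
move=> Sm N0 rS NS [[E eqN] SDr]; apply/eqP; rewrite -subr_eq0.
have le_D : (size D <= size N)%N by rewrite dvdp_leq // eqN dvdp_mull.
apply: contraT => Dr0; have := dvdZX_monic_leq Sm Dr0 SDr.
rewrite leqNgt (leq_ltn_trans (size_polyD _ _)) // size_polyN gtn_max rS andbT.
exact: leq_ltn_trans le_D NS.
Qed.

Theorem theorem1p3 :
  exists (p : prog) (C : nat),
  forall N S r : {poly int},
    N \is monic -> S \is monic -> r \is monic ->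
    gcd1ZX N S -> gcd1ZX S r ->
    (deg N <= 3 * deg S)%N ->
    exists (s' : store) (out : seq {poly int}) (n : nat),
      exec p (input N S r) s' out n /\
      (forall D : {poly int},
          D \in out <-> dvdZX D N /\ exists f : {poly int}, D = S * f + r) /\
      (n <= C * (deg N).+1)%N.
Proof.
(* [c0] pays for the test of [r] modulo [S] and the two divisions around it, [c1] for the loop-free
   code of [divisors_large], and [c2] for both Euclidean runs per unit of [size S]. *)
pose c0 := (cost test + 2)%N.
pose c1 := (cost (PCopy vy vr ;; load) + cost between)%N.
pose c2 := (2 * (cost euclid_step + (cost search + cost euclid_step)))%N.
exists divisors, (c0 + c1 + c2)%N => N S r Nm Sm _ _ Sr leN.
have N0 := monic_neq0 Nm; have S0 := monic_neq0 Sm.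
have N_gt0 := N0; have S_gt0 := S0; rewrite !neq0_sizeZ in N_gt0 S_gt0.
have sN : (deg N).+1 = size N by rewrite /deg prednK.
pose r0 := (edivZX r S).2; have [eq_r lt_r] := edivZX_monic (a := r) Sm.
rewrite -/r0 in lt_r.
pose reduce := POp (ODiv v3 vr vr vS) ;; PCopy vD vr.
pose s1 := final reduce (input N S r); pose s2 := final test s1.
pose s3 := final (POp (ODiv vy v3 vN vS)) s2.
have [n1 ex1 le1] := exec_loop_free reduce (input N S r) isT.
have [n2 ex2 le2] := exec_loop_free test s1 isT.
have [n3 ex3 le3] := exec_loop_free (POp (ODiv vy v3 vN vS)) s2 isT.
rewrite -/s1 in ex1; rewrite -/s2 in ex2; rewrite -/s3 in ex3.
have [N1 S1 r1 D1] : [/\ s1 vN = N, s1 vS = S, s1 vr = r0 & s1 vD = r0] by [].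
have ag12 : agree v1 s1 s2 := final_agree v1 test s1 isT.
have ag13 : agree v1 s1 s3 by apply: agree_trans ag12 _; exact: final_agree.
have [N3 S3 r3] : [/\ s3 vN = N, s3 vS = S & s3 vr = r0] by rewrite !ag13.
have y3 : s3 vy = (edivZX N S).1.
  have -> : s3 vy = (edivZX (s2 vN) (s2 vS)).1 by [].
  by rewrite !ag12.
have testP D : D \in outputs test s1 <-> D = r0 /\ good N S r0 D.
  by have := mem_test s1 D; rewrite N1 S1 r1 D1; apply.
rewrite -[outputs reduce _]/[::] -[outputs (POp _) _]/[::] in ex1 ex3.
have le_c0 : (n1 + (n2 + n3) <= c0)%N.
  by rewrite addnCA leq_add // (leq_add le1 le3).
have exec_divisors s4 out n4 :
    exec (PIfZero vy PSkip divisors_large) s3 s4 out n4 ->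
    exec divisors (input N S r) s4 (outputs test s1 ++ out)
      (n1 + (n2 + (n3 + n4))).
  move=> ex4; exact: exec_seq ex1 (exec_seq ex2 (exec_seq ex3 ex4)).
have [y0|y_neq0] := eqVneq (s3 vy) 0.
  exists s3, (outputs test s1 ++ [::]), (n1 + (n2 + (n3 + 0)))%N; split.
    by apply: exec_divisors; apply: exec_if_zero => //; constructor.
  split=> [D|].
    rewrite cats0 testP -(good_rem Sm); split=> [[]//|gD]; split=> //.
    apply: (good_small Sm N0 lt_r) => //; rewrite ltnNge; apply/negP => leS.
    have [/monic_neq0] := edivZX_quo_monic Nm Sm leS.
    by rewrite -y3 y0 eqxx.
  rewrite addn0 sN; apply: leq_trans le_c0 (leq_trans _ (leq_pmulr _ N_gt0)).
  exact: leq_trans (leq_addr c1 c0) (leq_addr c2 _).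
have leS : (size S <= size N)%N.
  by rewrite leqNgt; apply: contraNN y_neq0 => lt_N; rewrite y3 edivZX_small.
have [|s4 [out [n4 [ex4 sound4 complete4 le4]]]] :=
  divisors_large_exec N S r0 s3 Nm Sm (gcd1ZX_rem Sm Sr) lt_r _ N3 S3 r3.
  by rewrite /deg in leN; lia.
exists s4, (outputs test s1 ++ out), (n1 + (n2 + (n3 + n4)))%N; split.
  by apply: exec_divisors; apply: exec_if_nonzero => //; apply/eqP.
split=> [D|].
  rewrite -(good_rem Sm) mem_cat; split.
    by move=> /orP [/testP []|/sound4].
  move=> gD; have [D_eq|D_neq] := eqVneq D r0.
    by apply/orP; left; apply/testP.
  by rewrite complete4 ?orbT.
have -> : (n1 + (n2 + (n3 + n4)) = n1 + (n2 + n3) + n4)%N by rewrite !addnA.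
rewrite sN -(addnA c0) mulnDl mulnDl.
apply: leq_add; first exact: leq_trans le_c0 (leq_pmulr _ N_gt0).
apply: leq_trans le4 (leq_add (leq_pmulr _ N_gt0) _).
by rewrite leq_mul2l leS orbT.
Qed.
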